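(* Let $0\le a<b$, $0\le c<d$, $\Delta=[a,b]\times[c,d]$, and let $f:\Delta\to\mathbb{R}$ be a partial differentiable mapping on $\Delta$ with $\frac{\partial^2 f}{\partial t\partial\lambda}\in L(\Delta)$. Let $s\in(0,1]$ be fixed and suppose that $D:=\left|\frac{\partial^2 f}{\partial t\partial\lambda}\right|$ is $s$-convex on the co-ordinates on $\Delta$. Then for $x\in[a,b]$ and $y\in[c,d]$, $$\left|\frac{1}{(b-a)(d-c)}\left[A-(x-a)\int_c^d f(a,v)\,dv-(b-x)\int_c^d f(b,v)\,dv-(d-y)\int_a^b f(u,d)\,du-(y-c)\int_a^b f(u,c)\,du+\int_a^b\int_c^d f(u,v)\,du\,dv\right]\right|$$ $$\le \frac{1}{(b-a)(d-c)(s+2)^2}\Bigg[\frac{\left((x-a)^2+(b-x)^2\right)\left((y-c)^2+(d-y)^2\right)}{(s+1)^2}D(x,y)$$ $$+\frac{(x-a)^2\left((y-c)^2+(d-y)^2\right)}{s+1}D(a,y)+\frac{(b-x)^2\left((y-c)^2+(d-y)^2\right)}{s+1}D(b,y)$$ $$+\frac{(y-c)^2\left((x-a)^2+(b-x)^2\right)}{s+1}D(x,c)+\frac{(d-y)^2\left((x-a)^2+(b-x)^2\right)}{s+1}D(x,d)$$ $$+(x-a)^2(y-c)^2D(a,c)+(x-a)^2(d-y)^2D(a,d)+(b-x)^2(y-c)^2D(b,c)+(b-x)^2(d-y)^2D(b,d)\Bigg],$$ where $$A=\frac{(x-a)(y-c)f(a,c)+(x-a)(d-y)f(a,d)}{(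b-a)(d-c)}+\frac{(b-x)(y-c)f(b,c)+(b-x)(d-y)f(b,d)}{(b-a)(d-c)}.$$
   Context: $\frac{\partial^2 f}{\partial t\partial\lambda}(u,v)$ denotes the mixed second partial derivative of $f$ with respect to its first and second variables, evaluated at $(u,v)$; $L(\Delta)$ is the space of integrable functions on $\Delta$. In the double integral $u$ ranges over $[a,b]$ and $v$ over $[c,d]$. For $s\in(0,1]$, a function $g:[\alpha,\beta]\to\mathbb{R}$ with $[\alpha,\beta]\subset[0,\infty)$ is $s$-convex (in the second sense) if $g(\mu u+(1-\mu)v)\le\mu^s g(u)+(1-\mu)^s g(v)$ for all $u,v\in[\alpha,\beta]$, $\mu\in[0,1]$. A function $g:\Delta=[a,b]\times[c,d]\to\mathbb{R}$ with $\Delta\subset[0,\infty)^2$ is $s$-convex on the co-ordinates on $\Delta$ if the partial mappings $u\mapsto g(u,y)$ on $[a,b]$ and $v\mapsto g(x,v)$ on $[c,d]$ are $s$-convex for all $y\in[c,d]$ and $x\in[a,b]$.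
   Formalization: The factor 1/((b-a)(d-c)) is applied to A only once: the left side is |A + (1/((b-a)(d-c)))[-(x-a)∫f(a,v)dv - ... + ∬f]|, since with A divided twice the claim fails, e.g. for f=1 on [0,2]×[0,2]. *)

(* Defs.v *)
From HB Require Import structures.
From mathcomp Require Import all_boot all_order all_algebra.
From mathcomp Require Import all_classical all_reals all_analysis.

Set Implicit Arguments.
Unset Strict Implicit.
Unset Printing Implicit Defensive.
Import Order.TTheory GRing.Theory Num.Theory.
Import numFieldNormedType.Exports.

Local Open Scope classical_set_scope.
Local Open Scope ring_scope.

(* A function on [a, b] x [c, d] is encoded as a total f : R -> R -> R.  All
   derivatives are taken within the segment, so they are one-sided at the
   endpoints and values of f off the rectangle are irrelevant. *)

Definition diff_quot (R : realType) (g : R -> R) (x : R) : R -> R :=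
  fun u => (g u - g x) / (u - x).

Definition derivable_within (R : realType) (I : set R) (g : R -> R) (x : R) :
    Prop :=
  cvg (diff_quot g x @ within I x^').

Definition derive_within (R : realType) (I : set R) (g : R -> R) (x : R) : R :=
  lim (diff_quot g x @ within I x^').

Definition partial1 (R : realType) (a b : R) (f : R -> R -> R) (u v : R) : R :=
  derive_within `[a, b] (fun t => f t v) u.

Definition partial2 (R : realType) (c d : R) (f : R -> R -> R) (u v : R) : R :=
  derive_within `[c, d] (f u) v.

(* d^2 f / (dt dlambda) = d/dt (df/dlambda): the second variable first. *)
Definition mixed_partial (R : realType) (a b c d : R) (f : R -> R -> R) :
    R -> R -> R :=
  partial1 a b (partial2 c d f).

(* Both first partials exist on the closed rectangle, and so does the mixed
   partial; existence is required everywhere, not almost everywhere. *)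
Definition partial_differentiable (R : realType) (a b c d : R)
    (f : R -> R -> R) : Prop :=
  forall u v : R, a <= u <= b -> c <= v <= d ->
    [/\ derivable_within `[a, b] (fun t => f t v) u,
        derivable_within `[c, d] (f u) v &
        derivable_within `[a, b] (fun t => partial2 c d f t v) u].

(* Borel measurability, which the product measure below asks for, costs nothing
   compared with Lebesgue measurability: if f is partial differentiable, then f
   is separately continuous, hence Borel, and its mixed partial is an iterated
   pointwise limit of difference quotients, hence Borel too. *)
Definition integrable_on_rectangle (R : realType) (a b c d : R)
    (g : R -> R -> R) : Prop :=
  ((@lebesgue_measure R) \x (@lebesgue_measure R))%E.-integrable
    (`[a, b] `*` `[c, d]) (fun p : R * R => (g p.1 p.2)%:E).

Definition s_convex (R : realType) (s al be : R) (g : R -> R) : Prop :=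
  forall u v m : R, al <= u <= be -> al <= v <= be -> 0 <= m <= 1 ->
    g (m * u + (1 - m) * v) <= m `^ s * g u + (1 - m) `^ s * g v.

Definition s_convex_coord (R : realType) (s a b c d : R) (g : R -> R -> R) :
    Prop :=
  (forall y : R, c <= y <= d -> s_convex s a b (fun u => g u y)) /\
  (forall x : R, a <= x <= b -> s_convex s c d (g x)).

(* The weights (x-a)(y-c), (x-a)(d-y), (b-x)(y-c), (b-x)(d-y) add up to
   (b-a)(d-c), so this is already a normalized average: it is not to be divided
   by (b-a)(d-c) again when it is combined with the integral terms. *)
Definition vertex_mean (R : realType) (a b c d : R) (f : R -> R -> R)
    (x y : R) : R :=
  ((x - a) * (y - c) * f a c + (x - a) * (d - y) * f a d)
    / ((b - a) * (d - c)) +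
  ((b - x) * (y - c) * f b c + (b - x) * (d - y) * f b d)
    / ((b - a) * (d - c)).

(* Main.v *)
Require Import Defs.
From HB Require Import structures.
From mathcomp Require Import all_boot all_order all_algebra.
From mathcomp Require Import all_classical all_reals all_analysis.
From mathcomp Require Import ring lra.
Import Order.TTheory GRing.Theory Num.Theory.
Import numFieldNormedType.Exports.
Local Open Scope classical_set_scope.
Local Open Scope ring_scope.

(** Multiplied by (b - a) (d - c), the quantity inside the absolute value is the
    iterated defect T_u T_v f, where

      T g = \int_[a,b] g - (x - a) g a - (b - x) g b

    in the first variable, and the same with c, d, y in the second
    ([endpoint_defect], [iterated_endpoint_defectE]).  For smooth f it equals the
    double integral of (u - x) (v - y) times the mixed partial, and the classical
    proof bounds the integrand by s-convexity.  Turning the defect into that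
    double integral would require the fundamental theorem of calculus and
    Fubini's theorem for partial derivatives that are not assumed continuous.
    The proof uses the mean value theorem instead, once per variable.

    In one variable, T g is the integral of the increments g u - g a over [a, x]
    plus that of g u - g b over [x, b].  If |g'| is at most an s-convex C, then
    the mean value inequality against a primitive of
    C x t ^ s + C p (1 - t) ^ s bounds these increments
    ([increments_dominated_derive]), and one more integration gives
    |T g| <= B(C), a combination of C x, C a, C b ([norm_endpoint_defect_le]).

    In two variables let D be the absolute value of the mixed partial and
    h u = T_v (f u).  The one-variable result in u dominates the increments of
    the second partial at every fixed v, by an expression that is s-convex in v;
    the one-variable result in v then shows that the increments of h are
    dominated by E u = B(D u) ([endpoint_defect_dominated]).  A last application
    to h gives |T_u h| <= B(E), which is the right-hand side.  That h is
    continuous, hence integrable, also follows from this domination: E is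
    s-convex, so it is bounded and h is Lipschitz. *)

(** * Derivatives within a segment *)

Lemma is_derive_diff_quot {R : realType} (g : R -> R) (x l : R) :
  diff_quot g x @ x^' --> l -> is_derive x 1 g l.
Proof.
move=> gl.
have shiftx : h + x @[h --> 0^'] --> (0 + x)^'.
  apply: (@continuous_injective_withinNx R R (fun h : R => h + x) 0).
    by apply: cvgD; [exact: cvg_id|exact: cvg_cst].
  by move=> h /addIr.
rewrite add0r in shiftx.
have gl0 : h^-1 *: ((g \o shift x) (h *: 1) - g x) @[h --> 0^'] --> l.
  have := cvg_comp _ _ shiftx gl; apply: cvg_trans; apply: near_eq_cvg.
  near=> h; rewrite /= /diff_quot /shift/= addrK mulrC.
  by rewrite [h%:A]mulr1.
by apply: DeriveDef; [exact: (cvgP l)|exact: cvg_lim].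
Unshelve. all: by end_near. Qed.

(** At an interior point the punctured neighbourhoods relative to the segment
    are the ordinary ones, so the one-sided notion of derivative is the usual
    one there; this is all that mean value arguments ask for. *)
Lemma derivable_within_is_derive {R : realType} (a b x : R) (g : R -> R) :
  a < x < b -> derivable_within `[a, b] g x ->
  is_derive x 1 g (derive_within `[a, b] g x).
Proof.
move=> /andP[ax xb] dg; apply: is_derive_diff_quot.
have near_itv : \forall u \near x, `[a, b]%classic u.
  near=> u; rewrite /= in_itv/=; apply/andP; split; apply: ltW; near: u.
  - exact: lt_nbhsr.
  - exact: lt_nbhsl.
apply: cvg_trans dg => W /= Wg.
by move: near_itv Wg; apply: filterS2 => u /= Iu Wu ux; exact: Wu.
Unshelve. all: by end_near. Qed.

Lemma derivable_within_cvg {R : realType} (A : set R) (g : R -> R) (x : R) :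
  derivable_within A g x -> g u @[u --> within A (nbhs x)] --> g x.
Proof.
move=> dg.
suff gx : g u @[u --> within A x^'] --> g x.
  move=> W Wx; have Wg : \forall u \near x, u != x -> A u -> W (g u) := gx W Wx.
  suff : \forall u \near x, A u -> W (g u) by [].
  move: Wg.
  apply: filterS => u /= Wu Au.
  by have [->|ux] := eqVneq u x; [exact: nbhs_singleton|exact: Wu].
have -> : g x = g x + (x - x) * derive_within A g x by rewrite subrr mul0r addr0.
have ux : u @[u --> within A x^'] --> x.
  by apply: cvg_within_filter; apply: cvg_within.
have : g x + (u - x) * diff_quot g x u @[u --> within A x^'] -->
       g x + (x - x) * derive_within A g x.
  apply: cvgD; first exact: cvg_cst.
  by apply: cvgM => //; apply: cvgB => //; exact: cvg_cst.
apply: cvg_trans; apply: near_eq_cvg; rewrite near_withinE.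
rewrite /dnbhs near_withinE; near=> u => /= ux' _.
by rewrite /diff_quot mulrC divfK ?subr_eq0// addrC subrK.
Unshelve. all: by end_near. Qed.

(** * Positive-part powers *)

(** The positive-part power max(t, 0) ^ r.  Since [0 `^ r] is 0 but a negative
    base gives 1, [powR] is not continuous at 0; this extension by 0 is
    continuous for r > 0 and differentiable everywhere for exponents above 1,
    so that no endpoint has to be treated apart. *)
Definition pos_powR {R : realType} (r t : R) : R :=
  if 0 < t then t `^ r else 0.

Lemma pos_powRE {R : realType} (r t : R) : 0 < r -> 0 <= t -> pos_powR r t = t `^ r.
Proof.
move=> r0; rewrite /pos_powR le_eqVlt => /predU1P[<-|->//].
by rewrite ltxx powR0 ?gt_eqF.
Qed.

(** Holds on both sides of 0, and makes the difference quotient of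
    [pos_powR (r + 1)] at 0 equal to [pos_powR r]. *)
Lemma pos_powRS {R : realType} (r t : R) : pos_powR (r + 1) t = t * pos_powR r t.
Proof.
rewrite /pos_powR; case: ifPn => [t0|_]; last by rewrite mulr0.
by rewrite powRD ?(gt_eqF t0) ?implybT//= powRr1 1?mulrC// ltW.
Qed.

Lemma continuous_pos_powR {R : realType} (r : R) : 0 < r -> continuous (pos_powR r).
Proof.
move=> r0 x; have [x0|x0|->] := ltgtP x 0.
- have : (0 : R) @[_ --> x] --> pos_powR r x.
    by rewrite /pos_powR ltNge (ltW x0)/=; exact: cvg_cst.
  apply: cvg_trans; apply: near_eq_cvg; near=> t.
  by rewrite /pos_powR ltNge ltW//; near: t; exact: lt_nbhsl.
- have : t `^ r @[t --> x] --> pos_powR r x.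
    have pc : {for x, continuous (@powR R ^~ r)}.
      apply: differentiable_continuous.
      by apply/derivable1_diffP; apply: derivable_powR; rewrite in_itv/= x0.
    by rewrite /pos_powR x0; exact: pc.
  apply: cvg_trans; apply: near_eq_cvg; near=> t.
  by rewrite /pos_powR ifT//; near: t; exact: lt_nbhsr.
- apply/left_right_continuousP; rewrite {2 4}/pos_powR ltxx; split.
  + have : (0 : R) @[_ --> (0 : R)^'-] --> (0 : R) by exact: cvg_cst.
    apply: cvg_trans; apply: near_eq_cvg; near=> t.
    by rewrite /pos_powR ltNge ltW.
  + have := powR_cvg0 r0; apply: cvg_trans; apply: near_eq_cvg; near=> t.
    by rewrite /pos_powR ifT.
Unshelve. all: by end_near. Qed.

Lemma is_derive_pos_powR {R : realType} (r t : R) : 0 < r ->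
  is_derive t 1 (pos_powR (r + 1)) ((r + 1) * pos_powR r t).
Proof.
move=> r0; have [t0|t0|->] := ltgtP t 0.
- rewrite {2}/pos_powR ltNge (ltW t0)/= mulr0.
  apply: (near_eq_is_derive (f := cst 0)) => //.
  by near=> u; rewrite /pos_powR ltNge ltW//; near: u; exact: lt_nbhsl.
- rewrite [X in _ * X]/pos_powR t0.
  have := is_derive1_powR (r + 1) t0; rewrite addrK.
  apply: near_eq_is_derive; near=> u.
  by rewrite /pos_powR ifT//; near: u; exact: lt_nbhsr.
- apply: is_derive_diff_quot.
  have pos_powR0 : pos_powR r 0 = 0 :> R by rewrite /pos_powR ltxx.
  have := (continuous_withinNx _ _).1 (continuous_pos_powR r r0 0).
  rewrite pos_powR0 mulr0; apply: cvg_trans; apply: near_eq_cvg.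
  near=> u; rewrite /diff_quot !pos_powRS mul0r !subr0 mulrC mulKf//.
  by near: u; exact: nbhs_dnbhs_neq.
Unshelve. all: by end_near. Qed.

(** * Increments dominated by an s-convex function *)

(** The primitive, vanishing at 0, of C1 t ^ s + C0 (1 - t) ^ s, which is the
    majorant that s-convexity gives at the point t x + (1 - t) p for a function
    with values C0 at p and C1 at x. *)
Definition powR_prim {R : realType} (s C0 C1 t : R) : R :=
  (C1 * pos_powR (s + 1) t + C0 * (1 - pos_powR (s + 1) (1 - t))) / (s + 1).

(** The integrated form of [|g'| <= C] for an s-convex C: it mentions increments
    of g only, so it can be stated for a function not known to be
    differentiable, such as [fun u => endpoint_defect c d y (f u)] below. *)
Definition increments_dominated {R : realType} (s a b : R) (C g : R -> R) : Prop :=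
  forall p x t : R, a <= p <= b -> a <= x <= b -> 0 <= t <= 1 ->
    `|g (t * x + (1 - t) * p) - g p| <= `|x - p| * powR_prim s (C p) (C x) t.

Lemma is_derive_comp_affine {R : realType} (f : R -> R) (k m t df : R) :
  is_derive (k * t + m) 1 f df ->
  is_derive t 1 (fun u => f (k * u + m)) (df * k).
Proof.
move=> fd.
have ad : is_derive t 1 (fun u : R => k * u + m) k.
  have -> : (fun u : R => k * u + m) = (k \*: id) + cst m by apply/funext.
  by apply: is_derive_eq; rewrite addr0 [k%:A]mulr1.
exact: (@is_derive1_comp R f (fun u => k * u + m) t df k).
Qed.

Lemma is_derive_powR_prim {R : realType} (s C0 C1 t : R) : 0 < s ->
  is_derive t 1 (powR_prim s C0 C1) (C1 * pos_powR s t + C0 * pos_powR s (1 - t)).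
Proof.
move=> s0; have s1 : s + 1 != 0 by rewrite gt_eqF// addr_gt0.
have d1 := @is_derive_pos_powR R s t s0.
have := @is_derive_pos_powR R s (-1 * t + 1) s0.
move=> /is_derive_comp_affine d2.
have -> : powR_prim s C0 C1 =
    (C1 / (s + 1)) \*: pos_powR (s + 1) + cst (C0 / (s + 1)) -
    (C0 / (s + 1)) \*: (fun u => pos_powR (s + 1) (-1 * u + 1)).
  apply/funext => u; rewrite /powR_prim /= !fctE /= /GRing.scale/=.
  by rewrite mulN1r (addrC (- u)); field.
apply: is_derive_eq; rewrite /GRing.scale/= mulN1r (addrC (- t)).
by field.
Qed.

Lemma powR_prim0 {R : realType} (s C0 C1 : R) : 0 < s -> powR_prim s C0 C1 0 = 0.
Proof.
move=> s0; rewrite /powR_prim subr0 !pos_powRE// ?addr_gt0//.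
by rewrite powR0 ?gt_eqF ?addr_gt0// powR1 subrr !mulr0 addr0 mul0r.
Qed.

Lemma powR_prim1 {R : realType} (s C0 C1 : R) : 0 < s ->
  powR_prim s C0 C1 1 = (C0 + C1) / (s + 1).
Proof.
move=> s0; rewrite /powR_prim subrr !pos_powRE// ?addr_gt0//.
by rewrite powR0 ?gt_eqF ?addr_gt0// powR1 subr0 !mulr1 addrC.
Qed.

(** Mean value inequality: K - f and K + f are nondecreasing. *)
Lemma norm_increment_le {R : realType} (f df K dK : R -> R) (t : R) : 0 <= t <= 1 ->
  {within `[0, 1], continuous f} -> {within `[0, 1], continuous K} ->
  (forall u : R, 0 < u < 1 -> is_derive u 1 f (df u)) ->
  (forall u : R, 0 < u < 1 -> is_derive u 1 K (dK u)) ->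
  (forall u : R, 0 < u < 1 -> `|df u| <= dK u) ->
  `|f t - f 0| <= K t - K 0.
Proof.
move=> /andP[t0 t1] cf cK fd Kd le_df.
move: t0; rewrite le_eqVlt => /predU1P[<-|t0]; first by rewrite !subrr normr0.
have u01 u : u \in `]0, t[%R -> 0 < u < 1.
  by rewrite in_itv/= => /andP[-> /lt_le_trans->].
have sub01 : `[0, t] `<=` `[0, 1 : R].
  by move=> u /=; rewrite !in_itv/= => /andP[-> /le_trans->].
have cf' : {within `[0, t], continuous f} by exact: continuous_subspaceW cf.
have cK' : {within `[0, t], continuous K} by exact: continuous_subspaceW cK.
have [u /u01 u1 Eu] := @MVT R (K - f) (fun u => dK u - df u) 0 t t0
  (fun u hu => is_deriveB (Kd u (u01 u hu)) (fd u (u01 u hu)))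
  (within_continuousB cK' cf').
have [v /u01 v1 Ev] := @MVT R (K + f) (fun u => dK u + df u) 0 t t0
  (fun u hu => is_deriveD (Kd u (u01 u hu)) (fd u (u01 u hu)))
  (within_continuousD cK' cf').
move: (le_df _ u1) (le_df _ v1); rewrite !ler_norml => /andP[_ hu] /andP[hv _].
have : 0 <= (dK u - df u) * (t - 0) by rewrite subr0 mulr_ge0 ?subr_ge0// ltW.
have : 0 <= (dK v + df v) * (t - 0).
  by rewrite subr0 mulr_ge0 ?(ltW t0)// addrC -lerBlDr sub0r.
by rewrite -Eu -Ev /= !fctE => ? ?; apply/andP; split; lra.
Qed.

Lemma convex_comb_itv {R : realType} (a b p x t : R) :
  a <= p <= b -> a <= x <= b -> 0 <= t <= 1 -> a <= t * x + (1 - t) * p <= b.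
Proof. by move=> /andP[? ?] /andP[? ?] /andP[? ?]; apply/andP; split; nra. Qed.

Lemma within_continuous_conv {R : realType} (a b p x : R) (g : R -> R) :
  a <= p <= b -> a <= x <= b -> {within `[a, b], continuous g} ->
  {within `[0, 1], continuous (fun t => g (t * x + (1 - t) * p))}.
Proof.
move=> pab xab /subspace_continuousP cg; apply/subspace_continuousP => t t01.
have tab : `[a, b]%classic (t * x + (1 - t) * p).
  by rewrite /= in_itv/=; apply: convex_comb_itv => //; move: t01; rewrite /= in_itv.
have ct : {for t, continuous (fun t : R => t * x + (1 - t) * p)}.
  have -> : (fun t : R => t * x + (1 - t) * p) =
            (fun t : R => id ((x - p) * t + p)) by apply/funext => u /=; ring.
  apply: differentiable_continuous; apply/derivable1_diffP.
  by case: (is_derive_comp_affine id (x - p) p t 1 (is_derive_id _ _)).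
move=> W Wt.
have Wab : \forall v \near t * x + (1 - t) * p, `[a, b]%classic v -> W (g v) :=
  cg _ tab W Wt.
suff : \forall u \near t, `[0, 1]%classic u -> W (g (u * x + (1 - u) * p)) by [].
have : \forall u \near t, `[a, b]%classic (u * x + (1 - u) * p) ->
    W (g (u * x + (1 - u) * p)) := ct _ Wab.
apply: filterS => u /= Wu u01; apply: Wu.
by rewrite in_itv/=; apply: convex_comb_itv => //; move: u01; rewrite /= in_itv.
Qed.

(** The points are parametrized as t x + (1 - t) p with t in [0, 1], so both
    positions of x relative to p are one case.  In t the derivative of g is at
    most |x - p| (C x t ^ s + C p (1 - t) ^ s) by s-convexity. *)
Lemma increments_dominated_derive {R : realType} (s a b : R) (C g dg : R -> R) :
  0 < s -> {within `[a, b], continuous g} ->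
  (forall u : R, a < u < b -> is_derive u 1 g (dg u)) ->
  (forall u : R, a <= u <= b -> `|dg u| <= C u) ->
  s_convex s a b C -> increments_dominated s a b C g.
Proof.
move=> s0 cg gd le_dg convC p x t pab xab t01.
have [->|xp] := eqVneq x p.
  have -> : t * p + (1 - t) * p = p by ring.
  by rewrite !subrr normr0 mul0r.
have tab u : 0 < u < 1 -> a < u * x + (1 - u) * p < b.
  move=> /andP[u0 u1]; case/andP: pab xab => ? ? /andP[? ?].
  by case: (ltgtP x p) xp => // ? _; apply/andP; split; nra.
pose K (u : R) := `|x - p| * powR_prim s (C p) (C x) u.
have Kd (u : R) : is_derive u 1 K
    (`|x - p| * (C x * pos_powR s u + C p * pos_powR s (1 - u))).
  exact: (is_deriveZ `|x - p| (is_derive_powR_prim s (C p) (C x) u s0)).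
have K0 : K 0 = 0 by rewrite /K powR_prim0// mulr0.
have cK : continuous K.
  move=> u; apply: differentiable_continuous; apply/derivable1_diffP.
  by case: (Kd u).
have /= := @norm_increment_le R (fun t => g (t * x + (1 - t) * p))
  (fun u => dg (u * x + (1 - u) * p) * (x - p)) K
  (fun u => `|x - p| * (C x * pos_powR s u + C p * pos_powR s (1 - u))) t t01.
rewrite K0 subr0 mul0r add0r subr0 mul1r; apply.
- exact: within_continuous_conv cg.
- exact: continuous_subspaceT.
- move=> u u01.
  have -> : (fun t => g (t * x + (1 - t) * p)) =
            (fun t => g ((x - p) * t + p)).
    by apply/funext => v; congr g; ring.
  have -> : u * x + (1 - u) * p = (x - p) * u + p by ring.
  apply: is_derive_comp_affine; apply: gd.
  have -> : (x - p) * u + p = u * x + (1 - u) * p by ring.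
  exact: tab.
- move=> u u01; have /andP[u0 u1] := u01.
  rewrite normrM mulrC ler_wpM2l//.
  have uab : a <= u * x + (1 - u) * p <= b.
    by case/andP: (tab _ u01) => *; apply/andP; split; apply: ltW.
  apply: (le_trans (le_dg _ uab)).
  rewrite !pos_powRE ?subr_ge0 ?(ltW u0) ?(ltW u1)// (mulrC (C x)) (mulrC (C p)).
  by apply: (convC x p u) => //; rewrite (ltW u0) (ltW u1).
Qed.

(** * Comparing an integral with the values at the ends *)

(** For differentiable g this is - \int_a^b (u - x) g' u du, the one-dimensional
    form of the quantity to be estimated. *)
Definition endpoint_defect {R : realType} (a b x : R) (g : R -> R) : R :=
  \int[@lebesgue_measure R]_(u in `[a, b]) g u - (x - a) * g a - (b - x) * g b.

(** 1 / ((s + 1) (s + 2)) and 1 / (s + 2) are the integrals over [0, 1] of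
    (1 - t) t ^ s and (1 - t) (1 - t) ^ s. *)
Definition defect_bound {R : realType} (s a b x : R) (C : R -> R) : R :=
  (((x - a) ^+ 2 + (b - x) ^+ 2) * C x) / ((s + 1) * (s + 2))
  + ((x - a) ^+ 2 * C a + (b - x) ^+ 2 * C b) / (s + 2).

Lemma within_continuous_integrable {R : realType} (a b : R) (g : R -> R) :
  {within `[a, b], continuous g} ->
  (@lebesgue_measure R).-integrable `[a, b] (EFin \o g).
Proof.
by move=> cg; apply: continuous_compact_integrable => //; exact: segment_compact.
Qed.

Lemma continuous_powR_prim_affine {R : realType} (s C0 C1 p x : R) : 0 < s ->
  continuous (fun u => powR_prim s C0 C1 ((u - p) / (x - p))).
Proof.
move=> s0 u; apply: differentiable_continuous; apply/derivable1_diffP.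
have -> : (fun u => powR_prim s C0 C1 ((u - p) / (x - p))) =
    (fun u => powR_prim s C0 C1 ((x - p)^-1 * u + - p / (x - p))).
  by apply/funext => v; rewrite mulrBl mulNr (mulrC v).
have := @is_derive_powR_prim R s C0 C1 ((x - p)^-1 * u + - p / (x - p)) s0.
by move=> /is_derive_comp_affine[].
Qed.

Lemma powR_primZ {R : realType} (s k C0 C1 t : R) :
  k * powR_prim s C0 C1 t = powR_prim s (k * C0) (k * C1) t.
Proof. by rewrite /powR_prim mulrA mulrDr !mulrA. Qed.

(** The parameter (u - p) / (x - p) runs from 0 to 1 or from 1 to 0 according to
    which end of the segment p is; the sign of x - p compensates. *)
Lemma Rintegral_powR_prim {R : realType} (s C0 C1 l r p x : R) : 0 < s -> l < r ->
  (p = l /\ x = r) \/ (p = r /\ x = l) ->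
  \int[@lebesgue_measure R]_(u in `[l, r]) powR_prim s C0 C1 ((u - p) / (x - p)) =
  (r - l) * (C1 / ((s + 1) * (s + 2)) + C0 / (s + 2)).
Proof.
move=> s0 lr px.
have s1 : s + 1 != 0 by rewrite gt_eqF// addr_gt0.
have s2 : s + 2 != 0 by rewrite gt_eqF// addr_gt0.
have xp : x - p != 0.
  by rewrite subr_eq0; case: px => -[-> ->]; rewrite ?(gt_eqF lr) ?(lt_eqF lr).
(* A primitive of [powR_prim s C0 C1]. *)
pose Q (t : R) := (C1 * pos_powR (s + 1 + 1) t / (s + 2)
   + C0 * (t + pos_powR (s + 1 + 1) (1 - t) / (s + 2))) / (s + 1).
have Qd (t : R) : is_derive t 1 Q (powR_prim s C0 C1 t).
  have d1 := @is_derive_pos_powR R (s + 1) t (addr_gt0 s0 ltr01).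
  have := @is_derive_pos_powR R (s + 1) (-1 * t + 1) (addr_gt0 s0 ltr01).
  move=> /is_derive_comp_affine d2.
  have -> : Q = (C1 / (s + 2) / (s + 1)) \*: pos_powR (s + 1 + 1)
     + (C0 / (s + 1)) \*: id + (C0 / (s + 2) / (s + 1)) \*:
         (fun u => pos_powR (s + 1 + 1) (-1 * u + 1)).
    apply/funext => u; rewrite /Q /= !fctE /= /GRing.scale/=.
    by rewrite mulN1r (addrC (- u)); field; rewrite s1 s2.
  apply: is_derive_eq; rewrite /GRing.scale/= mulN1r (addrC (- t)) /powR_prim.
  by field; rewrite s1 s2.
have Q01 : Q 1 - Q 0 = C1 / ((s + 1) * (s + 2)) + C0 / (s + 2).
  rewrite /Q subrr subr0 !pos_powRE ?addr_gt0// powR1 powR0 ?gt_eqF ?addr_gt0//.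
  by field; rewrite s1 s2.
pose F (u : R) := (x - p) * Q ((x - p)^-1 * u + - p / (x - p)).
have affE (u : R) : (x - p)^-1 * u + - p / (x - p) = (u - p) / (x - p) by field.
have Fd (u : R) : is_derive u 1 F (powR_prim s C0 C1 ((u - p) / (x - p))).
  have := Qd ((x - p)^-1 * u + - p / (x - p)).
  move=> /is_derive_comp_affine/(is_deriveZ (x - p)) d.
  by apply: (is_derive_eq d); rewrite affE /GRing.scale/=; field.
have cF : continuous F.
  move=> u; apply: differentiable_continuous; apply/derivable1_diffP.
  by case: (Fd u).
rewrite /Rintegral (@continuous_FTC2 _ _ F)//=.
- rewrite /F !affE -Q01; case: px xp => -[-> ->] lr0.
    by rewrite subrr mul0r divff// mulrBr.
  by rewrite subrr mul0r divff// mulrBr; ring.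
- exact: continuous_subspaceT (continuous_powR_prim_affine _ _ _ _ _ s0).
- split => [u _||]; first by case: (Fd u).
  + by apply: cvg_at_right_filter; exact: cF.
  + by apply: cvg_at_left_filter; exact: cF.
- by move=> u _; rewrite derive1E; exact: (@derive_val _ _ _ _ _ _ _ (Fd u)).
Qed.

Lemma norm_Rintegral_increment_le {R : realType} (s C0 C1 l r p x : R)
    (g : R -> R) : 0 < s -> l <= r -> (p = l /\ x = r) \/ (p = r /\ x = l) ->
  {within `[l, r], continuous g} ->
  (forall t, 0 <= t <= 1 ->
    `|g (t * x + (1 - t) * p) - g p| <= `|x - p| * powR_prim s C0 C1 t) ->
  `|\int[@lebesgue_measure R]_(u in `[l, r]) g u - (r - l) * g p| <=
  (r - l) ^+ 2 * (C1 / ((s + 1) * (s + 2)) + C0 / (s + 2)).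
Proof.
move=> s0; rewrite le_eqVlt => /predU1P[->|lr] px cg le_g.
  by rewrite set_itv1 Rintegral_set1 !subrr expr0n/= !mul0r subrr normr0.
have xp : x - p != 0.
  by rewrite subr_eq0; case: px => -[-> ->]; rewrite ?(gt_eqF lr) ?(lt_eqF lr).
have nxp : `|x - p| = r - l.
  case: px => -[-> ->]; first by rewrite gtr0_norm// subr_gt0.
  by rewrite distrC gtr0_norm// subr_gt0.
have cc : {within `[l, r], continuous (cst (g p) : R -> R)}.
  by apply: continuous_subspaceT => u; exact: cvg_cst.
have cgp : {within `[l, r], continuous (g - cst (g p) : R -> R)}.
  exact: within_continuousB cg cc.
have cK : {within `[l, r], continuous
    (fun u => powR_prim s (`|x - p| * C0) (`|x - p| * C1) ((u - p) / (x - p)))}.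
  exact: continuous_subspaceT (continuous_powR_prim_affine _ _ _ _ _ s0).
have -> : \int[@lebesgue_measure R]_(u in `[l, r]) g u - (r - l) * g p =
    \int[@lebesgue_measure R]_(u in `[l, r]) (g u - g p).
  rewrite RintegralB//; [|exact: within_continuous_integrable..].
  by rewrite Rintegral_cst//= lebesgue_measure_itv/= lte_fin lr mulrC.
have ig : (@lebesgue_measure R).-integrable `[l, r]
    (EFin \o (fun u => g u - g p)) by exact: within_continuous_integrable.
apply: (le_trans (le_normr_Rintegral _ ig)) => //.
have -> : (r - l) ^+ 2 * (C1 / ((s + 1) * (s + 2)) + C0 / (s + 2)) =
   \int[@lebesgue_measure R]_(u in `[l, r])
      powR_prim s (`|x - p| * C0) (`|x - p| * C1) ((u - p) / (x - p)).
  by rewrite (Rintegral_powR_prim s _ _ l r p x)// nxp; ring.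
apply: le_Rintegral => //.
- exact: (integrable_norm ig).
- exact: within_continuous_integrable.
- move=> u; rewrite /= in_itv/= => /andP[lu ur].
  have uE : u = (u - p) / (x - p) * x + (1 - (u - p) / (x - p)) * p by field.
  rewrite {1}uE -powR_primZ; apply: le_g.
  case: px => -[pE xE].
  - have h : 0 < x - p by rewrite pE xE subr_gt0.
    apply/andP; split; first by rewrite divr_ge0 ?(ltW h)// pE subr_ge0.
    by rewrite ler_pdivrMr// mul1r xE lerB.
  - have h : 0 < p - x by rewrite pE xE subr_gt0.
    have -> : (u - p) / (x - p) = (p - u) / (p - x).
      by field; rewrite xp gt_eqF.
    apply/andP; split; first by rewrite divr_ge0 ?(ltW h)// pE subr_ge0.
    by rewrite ler_pdivrMr// mul1r xE lerB.
Qed.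

(** The defect is the sum of the integrals of [g u - g a] over [a, x] and of
    [g u - g b] over [x, b], that is, of increments from the ends. *)
Lemma norm_endpoint_defect_le {R : realType} (s a b x : R) (C g : R -> R) :
  0 < s -> a <= x <= b -> {within `[a, b], continuous g} ->
  increments_dominated s a b C g ->
  `|endpoint_defect a b x g| <= defect_bound s a b x C.
Proof.
move=> s0 axb cg domg; have /andP[ax xb] := axb.
have aab : a <= a <= b by rewrite lexx (le_trans ax).
have bab : a <= b <= b by rewrite lexx (le_trans ax).
have ig := within_continuous_integrable _ _ _ cg.
have cl : {within `[a, x], continuous g}.
  by apply: continuous_subspaceW cg; apply: subset_itvl; rewrite bnd_simp.
have cr : {within `[x, b], continuous g}.
  by apply: continuous_subspaceW cg; apply: subset_itvr; rewrite bnd_simp.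
have hl := norm_Rintegral_increment_le s (C a) (C x) a x a x g s0 ax
  (or_introl (conj erefl erefl)) cl (fun t => domg a x t aab axb).
have hr := norm_Rintegral_increment_le s (C b) (C x) x b b x g s0 xb
  (or_intror (conj erefl erefl)) cr (fun t => domg b x t bab axb).
have splitE : \int[@lebesgue_measure R]_(u in `[a, b]) g u =
    \int[@lebesgue_measure R]_(u in `[a, x]) g u +
    \int[@lebesgue_measure R]_(u in `[x, b]) g u.
  rewrite -(Rintegral_itv_obnd_cbnd (r := x)); last first.
    apply: integrableS (within_continuous_integrable _ _ _ cr) => //.
    by apply: subset_itvr; rewrite bnd_simp.
  by rewrite -(@Rintegral_itvB _ _ (BLeft a) (BRight b)) ?bnd_simp// addrC subrK.
have -> : endpoint_defect a b x g =
    (\int[@lebesgue_measure R]_(u in `[a, x]) g u - (x - a) * g a) +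
    (\int[@lebesgue_measure R]_(u in `[x, b]) g u - (b - x) * g b).
  by rewrite /endpoint_defect splitE; ring.
apply: (le_trans (ler_normD _ _)); apply: (le_trans (lerD hl hr)).
rewrite le_eqVlt; apply/orP; left; apply/eqP.
by rewrite /defect_bound; field; rewrite !gt_eqF ?addr_gt0.
Qed.

(** * s-convex majorants *)

Lemma s_convex_comb {R : realType} (s a b k m : R) (f g : R -> R) :
  0 <= k -> 0 <= m -> s_convex s a b f -> s_convex s a b g ->
  s_convex s a b (fun u => k * f u + m * g u).
Proof.
move=> k0 m0 cf cg u v t uab vab t01.
apply: (le_trans (lerD (ler_wpM2l k0 (cf u v t uab vab t01))
                       (ler_wpM2l m0 (cg u v t uab vab t01)))).
by rewrite le_eqVlt; apply/orP; left; apply/eqP; ring.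
Qed.

Lemma powR_itv01 {R : realType} (r t : R) : 0 <= r -> 0 <= t <= 1 ->
  0 <= t `^ r <= 1.
Proof.
move=> r0 /andP[t0 t1]; rewrite powR_ge0/=.
have -> : 1 = 1 `^ r :> R by rewrite powR1.
by rewrite ge0_ler_powR// nnegrE.
Qed.

(** An s-convex function is bounded because the weights m ^ s are at most 1. *)
Lemma s_convex_le_ends {R : realType} (s a b : R) (C : R -> R) :
  0 < s -> a < b -> (forall u, a <= u <= b -> 0 <= C u) -> s_convex s a b C ->
  forall u, a <= u <= b -> C u <= C a + C b.
Proof.
move=> s0 ab C0 convC u uab; have /andP[au ub] := uab.
have aab : a <= a <= b by rewrite lexx ltW.
have bab : a <= b <= b by rewrite lexx ltW.
have ba0 : 0 < b - a by rewrite subr_gt0.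
pose m := (b - u) / (b - a).
have m01 : 0 <= m <= 1.
  rewrite divr_ge0 ?(ltW ba0) ?subr_ge0//=.
  by rewrite ler_pdivrMr// mul1r lerB.
have uE : u = m * a + (1 - m) * b by rewrite /m; field; rewrite gt_eqF.
have m'01 : 0 <= 1 - m <= 1.
  by case/andP: m01 => ? ?; apply/andP; split; lra.
have /andP[_ ms] := powR_itv01 s m (ltW s0) m01.
have /andP[_ m's] := powR_itv01 s (1 - m) (ltW s0) m'01.
rewrite {1}uE; apply: (le_trans (convC a b m aab bab m01)).
by apply: lerD; rewrite ler_piMl// C0.
Qed.

(** With t = 1 the domination says that g is Lipschitz. *)
Lemma increments_dominated_continuous {R : realType} (s a b M : R) (C g : R -> R) :
  0 < s -> (forall u, a <= u <= b -> C u <= M) ->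
  increments_dominated s a b C g -> {within `[a, b], continuous g}.
Proof.
move=> s0 CM domg; apply/subspace_continuousP => p /=; rewrite in_itv/= => pab.
have s10 : 0 < s + 1 by rewrite addr_gt0.
have le_g u : a <= u <= b -> `|g u - g p| <= (M + M) / (s + 1) * `|u - p|.
  move=> uab.
  have := domg p u 1 pab uab; rewrite lexx ler01 => /(_ isT).
  rewrite mul1r subrr mul0r addr0 powR_prim1// mulrC => /le_trans; apply.
  rewrite ler_wpM2r// ler_pM2r ?invr_gt0//.
  by apply: lerD; exact: CM.
have cl : (M + M) / (s + 1) * `|u - p| @[u --> p] --> (0 : R).
  have -> : (0 : R) = (M + M) / (s + 1) * `|p - p| by rewrite subrr normr0 mulr0.
  apply: cvgM; first exact: cvg_cst.
  by apply: cvg_norm; apply: cvgB; [exact: cvg_id|exact: cvg_cst].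
have cl' : (M + M) / (s + 1) * `|u - p| @[u --> within `[a, b] (nbhs p)] --> (0 : R).
  exact: cvg_within_filter cl.
apply: cvg_zero; apply: norm_cvg0; apply: (squeeze_cvgr _ (@cvg_cst _ _ _ _ _) cl').
apply: filterS (withinT `[a, b] (nbhs_filter p)) => u /=; rewrite in_itv/=.
by move=> uab; rewrite !fctE normr_ge0 le_g.
Qed.

(** * The iterated defect *)

Lemma endpoint_defectB {R : realType} (a b x : R) (f g : R -> R) :
  {within `[a, b], continuous f} -> {within `[a, b], continuous g} ->
  endpoint_defect a b x (f - g) = endpoint_defect a b x f - endpoint_defect a b x g.
Proof.
move=> cf cg; rewrite /endpoint_defect RintegralB//; last 2 first.
  exact: within_continuous_integrable.
  exact: within_continuous_integrable.
by rewrite /= !fctE; ring.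
Qed.

(** The heart of the two-dimensional argument.  The increment of the defect
    between p and w = t x + (1 - t) p is the defect of [f w - f p], whose
    derivative in v is the increment of [f2 ^~ v], hence is dominated by
    C v = |x - p| * powR_prim s (D p v) (D x v) t.  This C is again s-convex in
    v, so the one-dimensional estimate applies to it; as [defect_bound] is
    linear in C, the factor |x - p| * powR_prim can be pulled out of it. *)
Lemma endpoint_defect_dominated {R : realType} (s a b c d y : R)
    (f f2 D : R -> R -> R) :
  0 < s -> c <= y <= d ->
  (forall u, a <= u <= b -> {within `[c, d], continuous (f u)}) ->
  (forall u v : R, a <= u <= b -> c < v < d -> is_derive v 1 (f u) (f2 u v)) ->
  (forall v, c <= v <= d -> increments_dominated s a b (D ^~ v) (f2 ^~ v)) ->
  (forall u, a <= u <= b -> s_convex s c d (D u)) ->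
  increments_dominated s a b (fun u => defect_bound s c d y (D u))
    (fun u => endpoint_defect c d y (f u)).
Proof.
move=> s0 ycd cf fd dom2 convD p x t pab xab t01.
have wab := convex_comb_itv a b p x t pab xab t01.
set w := t * x + (1 - t) * p in wab *.
have s10 : 0 < s + 1 by rewrite addr_gt0.
(* Majorant in v of the derivative of [f w - f p]. *)
pose C v := `|x - p| * powR_prim s (D p v) (D x v) t.
have convC : s_convex s c d C.
  have -> : C = (fun v => `|x - p| * pos_powR (s + 1) t / (s + 1) * D x v +
      `|x - p| * (1 - pos_powR (s + 1) (1 - t)) / (s + 1) * D p v).
    by apply/funext => v; rewrite /C /powR_prim; field; rewrite gt_eqF.
  have t'01 : 0 <= 1 - t <= 1 by case/andP: t01 => *; apply/andP; split; lra.
  have /andP[t0 _] := t01; have /andP[t'0 _] := t'01.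
  have /andP[_ ht] := powR_itv01 (s + 1) (1 - t) (ltW s10) t'01.
  apply: s_convex_comb; [| |exact: convD|exact: convD].
  - by rewrite divr_ge0 ?(ltW s10)// mulr_ge0// pos_powRE// powR_ge0.
  - by rewrite divr_ge0 ?(ltW s10)// mulr_ge0// subr_ge0 pos_powRE.
have domC : increments_dominated s c d C (f w - f p).
  apply: (increments_dominated_derive s c d C (f w - f p)
    (fun v => f2 w v - f2 p v)) => //.
  - by apply: within_continuousB; exact: cf.
  - by move=> v vcd; apply: is_deriveB; exact: fd.
  - by move=> v vcd; exact: dom2.
rewrite -endpoint_defectB; [|exact: cf..].
apply: (le_trans (norm_endpoint_defect_le s c d y C _ s0 ycd _ domC)).
  by apply: within_continuousB; exact: cf.
rewrite le_eqVlt; apply/orP; left; apply/eqP.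
rewrite /defect_bound /C /powR_prim; field.
by rewrite !gt_eqF ?addr_gt0.
Qed.

Lemma s_convex_defect_bound {R : realType} (s a b c d y : R) (D : R -> R -> R) :
  0 < s -> c <= y <= d ->
  (forall v : R, c <= v <= d -> s_convex s a b (D ^~ v)) ->
  s_convex s a b (fun u => defect_bound s c d y (D u)).
Proof.
move=> s0 ycd convD; have /andP[cy yd] := ycd.
have s1 : 0 < s + 1 by rewrite addr_gt0.
have s2 : 0 < s + 2 by rewrite addr_gt0.
have -> : (fun u => defect_bound s c d y (D u)) = (fun u =>
    ((y - c) ^+ 2 + (d - y) ^+ 2) / ((s + 1) * (s + 2)) * D u y +
    1 * ((y - c) ^+ 2 / (s + 2) * D u c + (d - y) ^+ 2 / (s + 2) * D u d)).
  by apply/funext => u; rewrite /defect_bound; field; rewrite !gt_eqF.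
apply: s_convex_comb => //; last apply: s_convex_comb.
- by rewrite divr_ge0 ?addr_ge0 ?sqr_ge0// mulr_ge0 ?ltW.
- exact: convD.
- by rewrite divr_ge0 ?sqr_ge0// ltW.
- by rewrite divr_ge0 ?sqr_ge0// ltW.
- by apply: convD; rewrite lexx (le_trans cy).
- by apply: convD; rewrite lexx (le_trans cy).
Qed.

Lemma defect_bound_ge0 {R : realType} (s a b x : R) (C : R -> R) : 0 < s ->
  (forall u, 0 <= C u) -> 0 <= defect_bound s a b x C.
Proof.
move=> s0 C0.
have s1 : 0 <= s + 1 by rewrite addr_ge0 ?ltW.
have s2 : 0 <= s + 2 by rewrite addr_ge0 ?ltW.
have hD := mulr_ge0 s1 s2.
have hx := mulr_ge0 (addr_ge0 (sqr_ge0 (x - a)) (sqr_ge0 (b - x))) (C0 x).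
have ha := mulr_ge0 (sqr_ge0 (x - a)) (C0 a).
have hb := mulr_ge0 (sqr_ge0 (b - x)) (C0 b).
exact: addr_ge0 (divr_ge0 hx hD) (divr_ge0 (addr_ge0 ha hb) s2).
Qed.

(** The iterated defect is continuous in u, which is where integrability of the
    inner integral as a function of u comes from. *)
Lemma iterated_endpoint_defectE {R : realType} (a b c d x y : R) (f : R -> R -> R) :
  {within `[a, b], continuous (f ^~ c)} ->
  {within `[a, b], continuous (f ^~ d)} ->
  {within `[a, b], continuous (fun u => endpoint_defect c d y (f u))} ->
  let mu := @lebesgue_measure R in
  endpoint_defect a b x (fun u => endpoint_defect c d y (f u)) =
    (x - a) * (y - c) * f a c + (x - a) * (d - y) * f a d
    + (b - x) * (y - c) * f b c + (b - x) * (d - y) * f b d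
    - (x - a) * (\int[mu]_(v in `[c, d]) f a v)
    - (b - x) * (\int[mu]_(v in `[c, d]) f b v)
    - (d - y) * (\int[mu]_(u in `[a, b]) f u d)
    - (y - c) * (\int[mu]_(u in `[a, b]) f u c)
    + \int[mu]_(u in `[a, b]) (\int[mu]_(v in `[c, d]) f u v).
Proof.
move=> cfc cfd ch mu.
have ih := within_continuous_integrable _ _ _ ch.
have ic := within_continuous_integrable _ _ _ cfc.
have id := within_continuous_integrable _ _ _ cfd.
have iZ k (g : R -> R) : mu.-integrable `[a, b] (EFin \o g) ->
    mu.-integrable `[a, b] (EFin \o (fun u => k * g u)).
  by move=> ig; exact: (integrableZl _ k ig).
have iD (g1 g2 : R -> R) : mu.-integrable `[a, b] (EFin \o g1) ->
    mu.-integrable `[a, b] (EFin \o g2) ->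
    mu.-integrable `[a, b] (EFin \o (fun u => g1 u + g2 u)).
  by move=> i1 i2; exact: (integrableD _ i1 i2).
have -> : \int[mu]_(u in `[a, b]) (\int[mu]_(v in `[c, d]) f u v) =
    \int[mu]_(u in `[a, b]) endpoint_defect c d y (f u)
    + (y - c) * \int[mu]_(u in `[a, b]) f u c
    + (d - y) * \int[mu]_(u in `[a, b]) f u d.
  rewrite -!RintegralZl// -!RintegralD//; [|by auto..].
  by apply: eq_Rintegral => u _; rewrite /endpoint_defect; ring.
by rewrite /endpoint_defect; ring.
Qed.

Lemma iterated_defect_boundE {R : realType} (s a b c d x y : R)
    (D : R -> R -> R) :
  ((b - a) * (d - c))^-1 *
    defect_bound s a b x (fun u => defect_bound s c d y (D u)) =
  1 / ((b - a) * (d - c) * (s + 2) ^+ 2) *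
     (((x - a) ^+ 2 + (b - x) ^+ 2) * ((y - c) ^+ 2 + (d - y) ^+ 2)
        / (s + 1) ^+ 2 * D x y
      + (x - a) ^+ 2 * ((y - c) ^+ 2 + (d - y) ^+ 2) / (s + 1) * D a y
      + (b - x) ^+ 2 * ((y - c) ^+ 2 + (d - y) ^+ 2) / (s + 1) * D b y
      + (y - c) ^+ 2 * ((x - a) ^+ 2 + (b - x) ^+ 2) / (s + 1) * D x c
      + (d - y) ^+ 2 * ((x - a) ^+ 2 + (b - x) ^+ 2) / (s + 1) * D x d
      + (x - a) ^+ 2 * (y - c) ^+ 2 * D a c
      + (x - a) ^+ 2 * (d - y) ^+ 2 * D a d
      + (b - x) ^+ 2 * (y - c) ^+ 2 * D b c
      + (b - x) ^+ 2 * (d - y) ^+ 2 * D b d).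
Proof.
rewrite /defect_bound div1r !invfM.
(* Both sides are polynomials in the inverses, the squares and the values of D. *)
move: (b - a)^-1 (d - c)^-1 (s + 1)^-1 (s + 2)^-1 => k l m n.
move: ((x - a) ^+ 2) ((b - x) ^+ 2) ((y - c) ^+ 2) ((d - y) ^+ 2) => p q r t.
move: (D x y) (D a y) (D b y) (D x c) (D x d) (D a c) (D a d) (D b c) (D b d).
by move=> *; ring.
Qed.

(** * The estimate on the rectangle *)

Theorem theorem2 (R : realType) (a b c d s : R) (f : R -> R -> R)
    (ha : 0 <= a) (hab : a < b) (hc : 0 <= c) (hcd : c < d)
    (hs0 : 0 < s) (hs1 : s <= 1)
    (hf : partial_differentiable a b c d f)
    (hint : integrable_on_rectangle a b c d (mixed_partial a b c d f))
    (hconv : s_convex_coord s a b c d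
               (fun u v => `|mixed_partial a b c d f u v|))
    (x y : R) (hx : a <= x <= b) (hy : c <= y <= d) :
  let mu := @lebesgue_measure R in
  let D := fun u v : R => `|mixed_partial a b c d f u v| in
  let A := vertex_mean a b c d f x y in
  `| A + 1 / ((b - a) * (d - c)) *
       (- (x - a) * (\int[mu]_(v in `[c, d]) f a v)
        - (b - x) * (\int[mu]_(v in `[c, d]) f b v)
        - (d - y) * (\int[mu]_(u in `[a, b]) f u d)
        - (y - c) * (\int[mu]_(u in `[a, b]) f u c)
        + \int[mu]_(u in `[a, b]) (\int[mu]_(v in `[c, d]) f u v)) |
  <= 1 / ((b - a) * (d - c) * (s + 2) ^+ 2) *
     (((x - a) ^+ 2 + (b - x) ^+ 2) * ((y - c) ^+ 2 + (d - y) ^+ 2)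
        / (s + 1) ^+ 2 * D x y
      + (x - a) ^+ 2 * ((y - c) ^+ 2 + (d - y) ^+ 2) / (s + 1) * D a y
      + (b - x) ^+ 2 * ((y - c) ^+ 2 + (d - y) ^+ 2) / (s + 1) * D b y
      + (y - c) ^+ 2 * ((x - a) ^+ 2 + (b - x) ^+ 2) / (s + 1) * D x c
      + (d - y) ^+ 2 * ((x - a) ^+ 2 + (b - x) ^+ 2) / (s + 1) * D x d
      + (x - a) ^+ 2 * (y - c) ^+ 2 * D a c
      + (x - a) ^+ 2 * (d - y) ^+ 2 * D a d
      + (b - x) ^+ 2 * (y - c) ^+ 2 * D b c
      + (b - x) ^+ 2 * (d - y) ^+ 2 * D b d).
Proof.
move=> /=.
pose D u v := `|mixed_partial a b c d f u v|.
have ccd : c <= c <= d by rewrite lexx ltW.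
have dcd : c <= d <= d by rewrite lexx ltW.
have cf1 v : c <= v <= d -> {within `[a, b], continuous (f ^~ v)}.
  move=> vcd; apply/subspace_continuousP => u; rewrite /= in_itv/= => uab.
  by apply: derivable_within_cvg; case: (hf u v uab vcd).
have cf2 u : a <= u <= b -> {within `[c, d], continuous (f u)}.
  move=> uab; apply/subspace_continuousP => v; rewrite /= in_itv/= => vcd.
  by apply: derivable_within_cvg; case: (hf u v uab vcd).
have dom2 v : c <= v <= d ->
    increments_dominated s a b (D ^~ v) (partial2 c d f ^~ v).
  move=> vcd; apply: (increments_dominated_derive s a b _ _
    (mixed_partial a b c d f ^~ v)).
  - by [].
  - apply/subspace_continuousP => u; rewrite /= in_itv/= => uab.
    by apply: derivable_within_cvg; case: (hf u v uab vcd).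
  - move=> u uab; apply: derivable_within_is_derive => //.
    have uab' : a <= u <= b by case/andP: uab => /ltW-> /ltW->.
    by case: (hf u v uab' vcd).
  - by [].
  - exact: hconv.1.
pose h u := endpoint_defect c d y (f u); pose E u := defect_bound s c d y (D u).
have domh : increments_dominated s a b E h.
  apply: (endpoint_defect_dominated s a b c d y f (partial2 c d f)) => //.
  - move=> u v uab vcd; apply: derivable_within_is_derive => //.
    have vcd' : c <= v <= d by case/andP: vcd => /ltW-> /ltW->.
    by case: (hf u v uab vcd').
  - exact: hconv.2.
have E0 u : 0 <= E u by apply: defect_bound_ge0 => // v; exact: normr_ge0.
have convE : s_convex s a b E by apply: s_convex_defect_bound => //; exact: hconv.1.
have ch : {within `[a, b], continuous h}.
  apply: (increments_dominated_continuous s a b (E a + E b) E) => // u uab.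
  exact: (s_convex_le_ends s a b).
have ba0 : 0 < b - a by rewrite subr_gt0.
have dc0 : 0 < d - c by rewrite subr_gt0.
have := norm_endpoint_defect_le s a b x E h hs0 hx ch domh.
rewrite -(ler_pM2l (_ : 0 < ((b - a) * (d - c))^-1)); last first.
  by rewrite invr_gt0 mulr_gt0.
rewrite -[X in X * `|_|]gtr0_norm ?invr_gt0 ?mulr_gt0// -normrM.
rewrite (iterated_endpoint_defectE a b c d x y f (cf1 c ccd) (cf1 d dcd) ch).
rewrite /E (iterated_defect_boundE s a b c d x y D).
congr (`|_| <= _).
by rewrite /vertex_mean; field; rewrite !gt_eqF.
Qed.
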